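(* If $\mathcal{S}=(X,\mathcal{C},\mathcal{B}d)$ is a b0-space, then $\mathcal{B}d$ (ordered by inclusion) is a coframe, i.e. a complete lattice satisfying $a\vee\bigwedge B=\bigwedge\{a\vee b\mid b\in B\}$ for all $a\in\mathcal{B}d$ and $B\subseteq\mathcal{B}d$.
   Context: A closure system on a set $X$ is a family of subsets of $X$ containing $X$ and closed under arbitrary intersections; ordered by inclusion it is a complete lattice whose meets are intersections and whose joins $\vee$ are the least members containing the union. A basic zero-dimensional space (b0-space) is a triple $\mathcal{S}=(X,\mathcal{C},\mathcal{B}d)$ where $X$ is a set, $\mathcal{B}d$ is a closure system on $X$ that is distributive as a lattice, and $\mathcal{C}\subseteq\mathcal{B}d$ is such that every $C\in\mathcal{C}$ has a complement $\neg C$ in the lattice $\mathcal{B}d$, and every $M\in\mathcal{B}d$ is of the form $M=\bigcap_{i\in J}(C_i^1\vee\neg D_i^1\vee\dots\vee C_i^{n_i}\vee\neg D_i^{n_i})$ with all $C_i^k,D_i^k\in\mathcal{C}$ (finite joins in $\mathcal{B}d$, the empty join being allowed). *)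

(* Defs.v *)
From HB Require Import structures.
From mathcomp Require Import all_boot all_order.
From mathcomp Require Import boolp classical_sets.

Set Implicit Arguments.
Unset Strict Implicit.
Unset Printing Implicit Defensive.

Import Order.TTheory.
Local Open Scope classical_set_scope.

Definition complete_lattice (d : Order.disp_t) (L : porderType d) : Prop :=
  forall B : set L, supremums B !=set0 /\ infimums B !=set0.

(* [supremums B] and [infimums B] are the sets, with at most one element, of
   the least upper bounds and of the greatest lower bounds of [B]: below,
   [m] is the meet of [B] and [j] is the join of [a] and [m]. *)
Definition coframe (d : Order.disp_t) (L : porderType d) : Prop :=
  complete_lattice L /\
  forall (a : L) (B : set L) (m j : L),
    infimums B m -> supremums [set a; m] j ->
    infimums [set c | exists2 b, B b & supremums [set a; b] c] j.

Section ClosureSystem.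
Variable X : Type.
Implicit Types (F : set (set X)) (A B M N : set X).

(* The case [G = set0] is the membership of [setT]; it is nevertheless kept as
   a separate clause. *)
Definition closure_system F : Prop :=
  F setT /\ forall G : set (set X), G `<=` F -> F (\bigcap_(A in G) A).

Definition cs_bot F : set X := smallest F set0.

Definition cs_join F A B : set X := smallest F (A `|` B).

Definition cs_distributive F : Prop :=
  forall A B M, F A -> F B -> F M ->
    A `&` cs_join F B M = cs_join F (A `&` B) (A `&` M).

Definition cs_complement F A N : Prop :=
  [/\ F N, A `&` N = cs_bot F & cs_join F A N = setT].

(* Complements are unique when [F] is distributive; [set0] is a junk value for
   the sets without complement. *)
Definition cs_neg F A : set X := xget set0 [set N | cs_complement F A N].

End ClosureSystem.

Record b0_space (X : Type) (C Bd : set (set X)) : Prop := B0Space {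
  b0_closure_system : closure_system Bd;
  b0_distributive : cs_distributive Bd;
  b0_sub : C `<=` Bd;
  b0_complemented : forall A, C A -> exists N, cs_complement Bd A N;
  b0_generated : forall M, Bd M ->
    exists (J : Type) (n : J -> nat) (P Q : forall i : J, 'I_(n i) -> set X),
      (forall i k, C (P i k) /\ C (Q i k)) /\
      M = \bigcap_i \big[cs_join Bd/cs_bot Bd]_(k < n i)
                      cs_join Bd (P i k) (cs_neg Bd (Q i k))
}.

(* The carrier of a family of subsets of [X], partially ordered by inclusion
   (the order of [set X] is inclusion, see [subsetEset]). *)
HB.instance Definition _ (X : Type) (F : set (set X)) :=
  SubChoice.copy (set_type F) {A : set X | A \in F}.
HB.instance Definition _ (X : Type) (F : set (set X)) :=
  [SubChoice_isSubPOrder of set_type F by <: with set_display].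

(* Main.v *)
Require Import Defs.
From mathcomp Require Import all_boot all_order.
From mathcomp Require Import boolp classical_sets.

(** Meets in [Bd] are intersections, so the coframe law amounts to this: if
    [M] lies below [a \/ b] for every [b] in [B], then [M] lies below
    [j = a \/ (meet of B)].  Complemented elements form a sublattice of a
    distributive lattice, so each finite join in the generation axiom is
    complemented, and [j] is an intersection of complemented elements
    ([b0_meet_complemented]).  It is therefore enough to show that [M] is
    below every complemented [E] above [j].  If [N] is the complement of [E],
    then [M] is below [E \/ b] because [a] is below [E]; cutting with [N]
    removes [E], so [M /\ N] is below every [b] in [B], hence below their meet,
    hence below [E].  Since also [M /\ E] is below [E] and [E \/ N] is the top,
    distributivity puts [M] below [E]. *)

Set Implicit Arguments.
Unset Strict Implicit.
Unset Printing Implicit Defensive.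

Import Order.TTheory.
Local Open Scope classical_set_scope.

Section ClosureSystem.
Variables (X : Type) (F : set (set X)).
Hypothesis csF : closure_system F.
Implicit Types (A B E M N Z : set X) (G : set (set X)).

Lemma cs_smallest_closed A : F (smallest F A).
Proof. by rewrite /smallest; apply: csF.2 => M []. Qed.

Lemma cs_join_closed A B : F (cs_join F A B).
Proof. exact: cs_smallest_closed. Qed.

Lemma cs_setI A B : F A -> F B -> F (A `&` B).
Proof.
have -> : A `&` B = \bigcap_(M in [set A; B]) M.
  by rewrite bigcap_setU !bigcap_set1.
by move=> FA FB; apply: csF.2 => M [->|->].
Qed.

Lemma cs_bot_sub Z : F Z -> cs_bot F `<=` Z.
Proof. by move=> FZ; apply: smallest_sub. Qed.

Lemma cs_joinl A B : A `<=` cs_join F A B.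
Proof. by apply: sub_smallest; exact: subsetUl. Qed.

Lemma cs_joinr A B : B `<=` cs_join F A B.
Proof. by apply: sub_smallest; exact: subsetUr. Qed.

Lemma cs_join_sub A B Z : F Z -> A `<=` Z -> B `<=` Z -> cs_join F A B `<=` Z.
Proof. by move=> FZ AZ BZ; apply: smallest_sub => //; rewrite subUset. Qed.

Hypothesis distrF : cs_distributive F.

(** The form in which distributivity enters every argument below: an element
    is bounded by [Z] as soon as both its parts along a join are. *)
Lemma cs_setI_join_sub A B M Z : F A -> F B -> F M -> F Z ->
  A `&` B `<=` Z -> A `&` M `<=` Z -> A `&` cs_join F B M `<=` Z.
Proof. by move=> FA FB FM FZ ABZ AMZ; rewrite distrF//; apply: cs_join_sub. Qed.

Lemma cs_complement_sym A N : F A -> cs_complement F A N -> cs_complement F N A.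
Proof.
by move=> FA [FN AN0 ANT]; split=> //; [rewrite setIC | rewrite /cs_join setUC].
Qed.

Lemma cs_complement_bot : cs_complement F (cs_bot F) setT.
Proof.
split; [exact: csF.1 | by rewrite setIT |].
by rewrite -subTset; exact: cs_joinr.
Qed.

Lemma cs_complement_neg A :
  (exists N, cs_complement F A N) -> cs_complement F A (cs_neg F A).
Proof. by move=> [N AN]; exact: (xgetPex set0 (ex_intro _ N AN)). Qed.

(** De Morgan: the complement of a join is the meet of the complements. *)
Lemma cs_complement_join A A' B B' : F A -> F B ->
  cs_complement F A A' -> cs_complement F B B' ->
  cs_complement F (cs_join F A B) (A' `&` B').
Proof.
move=> FA FB [FA' A0 AT] [FB' B0 BT].
have FAB := cs_join_closed A B.
have FAB' : F (A' `&` B') by exact: cs_setI.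
have Fbot : F (cs_bot F) by exact: cs_smallest_closed.
split=> //.
- apply/seteqP; split; last by apply: cs_bot_sub; exact: cs_setI.
  rewrite setIC; apply: cs_setI_join_sub => //.
  + by rewrite -A0 => x [[? _] ?].
  + by rewrite -B0 => x [[_ ?] ?].
- rewrite -subTset -AT; set Z := cs_join F _ (A' `&` B').
  have FZ : F Z by exact: cs_join_closed.
  have ABZ : cs_join F A B `<=` Z by exact: cs_joinl.
  apply: cs_join_sub => //; first by apply: (subset_trans _ ABZ); exact: cs_joinl.
  (* Split A' along B \/ B' = top: the part in B lies in the first join, the
     part in B' is the second. *)
  rewrite -[A']setIT -BT; apply: cs_setI_join_sub => //; last exact: cs_joinr.
  by apply: (subset_trans _ ABZ) => x [_ Bx]; exact: cs_joinr.
Qed.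

(** The coframe law tested against a complemented [E]. Split [M] along
    [E \/ N]. The part in [N] is below [N /\ (E \/ B)], that is below [B], for
    every [B] in [G], hence below the meet of [G] and so below [E]. *)
Lemma cs_complemented_coframe E N A M G :
  F E -> F M -> G `<=` F -> cs_complement F E N ->
  A `<=` E -> \bigcap_(B in G) B `<=` E ->
  (forall B, G B -> M `<=` cs_join F A B) -> M `<=` E.
Proof.
move=> FE FM GF [FN EN0 ENT] AE GE MG.
rewrite -[M]setIT -ENT; apply: cs_setI_join_sub => //.
apply: (subset_trans _ GE) => x [Mx Nx] B GB; have FB := GF _ GB.
have sub : N `&` cs_join F E B `<=` B.
  apply: cs_setI_join_sub => //; rewrite setIC EN0; exact: cs_bot_sub.
apply: sub; split=> //; apply: cs_join_sub (MG _ GB _ Mx).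
- exact: cs_join_closed.
- by apply: (subset_trans AE); exact: cs_joinl.
- exact: cs_joinr.
Qed.

End ClosureSystem.

Section B0Space.
Variables (X : Type) (C Bd : set (set X)).
Hypothesis S : b0_space C Bd.

Let csBd := b0_closure_system S.
Let distrBd := b0_distributive S.

Definition cs_complemented (F : set (set X)) (E : set X) : Prop :=
  F E /\ exists N, cs_complement F E N.

Lemma cs_complemented_join A B : cs_complemented Bd A ->
  cs_complemented Bd B -> cs_complemented Bd (cs_join Bd A B).
Proof.
move=> [FA [A' AA']] [FB [B' BB']]; split; first exact: cs_join_closed.
by exists (A' `&` B'); exact: cs_complement_join.
Qed.

(** Each [cs_neg] is complemented by the generator it negates, and complemented
    elements are stable under finite joins. *)
Lemma b0_meet_complemented M : Bd M ->
  exists2 G : set (set X), G `<=` cs_complemented Bd & M = \bigcap_(E in G) E.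
Proof.
move=> /(b0_generated S)[J [n [P [Q [CPQ ->]]]]].
set E := fun i => \big[_/_]_(k < n i) _.
exists (range E); last by rewrite bigcap_image.
move=> _ [i _ <-]; apply: big_ind => [||k _].
- split; first exact: cs_smallest_closed.
  by exists setT; exact: cs_complement_bot.
- exact: cs_complemented_join.
- have [CP CQ] := CPQ i k.
  apply: cs_complemented_join.
    by split; [exact: (b0_sub S) | exact: (b0_complemented S)].
  have FQ := b0_sub S CQ.
  have QN := cs_complement_neg (b0_complemented S CQ).
  split; first by case: QN.
  by exists (Q i k); exact: cs_complement_sym.
Qed.

(** Being below an intersection of complemented elements can be tested on each
    of them separately. *)
Lemma b0_coframe_sub A M Z (G : set (set X)) : Bd M -> Bd Z -> G `<=` Bd ->
  A `<=` Z -> \bigcap_(B in G) B `<=` Z ->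
  (forall B, G B -> M `<=` cs_join Bd A B) -> M `<=` Z.
Proof.
move=> FM /b0_meet_complemented[H HE ->] GBd AH GH MG.
apply: sub_bigcap => E HE'; have [FE [N EN]] := HE _ HE'.
apply: (cs_complemented_coframe csBd distrBd FE FM GBd EN (A := A)) => //.
- by move=> x Ax; exact: (AH _ Ax _ HE').
- by move=> x Gx; exact: (GH _ Gx _ HE').
Qed.

End B0Space.

Section SetTypeOrder.
Variables (X : Type) (F : set (set X)).
Hypothesis csF : closure_system F.
Implicit Types (a b c : set_type F) (B : set (set_type F)).

Lemma set_type_leP a b : (a <= b)%O <-> val a `<=` val b.
Proof. by rewrite leEsub subsetEset. Qed.

Lemma set_type_closed a : F (val a).
Proof. by apply: set_mem; exact: valP. Qed.

Definition set_type_of A (FA : F A) : set_type F := exist _ A (mem_set FA).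

Lemma set_type_infimum B (FB : F (\bigcap_(A in val @` B) A)) :
  infimums B (set_type_of FB).
Proof.
split=> [b Bb | c cB]; apply/set_type_leP => /=.
- by apply: bigcap_inf; exists b.
- by apply: sub_bigcap => _ [b Bb <-]; apply/set_type_leP; exact: cB.
Qed.

Lemma set_type_supremum B (FB : F (smallest F (\bigcup_(b in B) val b))) :
  supremums B (set_type_of FB).
Proof.
split=> [b Bb | c cB]; apply/set_type_leP => /=.
- by apply: sub_smallest; exact: bigcup_sup.
- apply: smallest_sub; first exact: set_type_closed.
  by apply: bigcup_sub => b Bb; apply/set_type_leP; exact: cB.
Qed.

Lemma set_type_complete : complete_lattice (set_type F).
Proof.
move=> B; split.
- by eexists; apply: set_type_supremum; exact: cs_smallest_closed.
- eexists; apply: set_type_infimum; apply: csF.2 => _ [b _ <-].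
  exact: set_type_closed.
Qed.

Lemma set_type_join a b (FB : F (cs_join F (val a) (val b))) :
  supremums [set a; b] (set_type_of FB).
Proof.
split=> [c [->|->] | c cB]; apply/set_type_leP => /=.
- exact: cs_joinl.
- exact: cs_joinr.
- apply: cs_join_sub; first exact: set_type_closed.
  + by apply/set_type_leP; apply: cB; left.
  + by apply/set_type_leP; apply: cB; right.
Qed.

End SetTypeOrder.

Theorem proposition3p2 (X : Type) (C Bd : set (set X)) (S : b0_space C Bd) :
  coframe (set_type Bd).
Proof.
have csBd := b0_closure_system S.
split=> [|a B m j [mB m_max] [jub jmin]]; first exact: set_type_complete.
have /set_type_leP aj : (a <= j)%O by apply: jub; left.
have /set_type_leP mj : (m <= j)%O by apply: jub; right.
split=> [c [b Bb [cub _]] | x xlb].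
- apply: jmin => _ [->|->]; first by apply: cub; left.
  by apply: le_trans (mB _ Bb) (cub _ _); right.
have FB : Bd (\bigcap_(A in val @` B) A).
  by apply: csBd.2 => _ [b _ <-]; exact: set_type_closed.
apply/set_type_leP.
apply: (b0_coframe_sub S (A := val a) (G := val @` B)) => //.
- exact: set_type_closed.
- exact: set_type_closed.
- by move=> _ [b _ <-]; exact: set_type_closed.
- apply: (subset_trans _ mj); apply/(set_type_leP (set_type_of FB)).
  by apply: m_max; case: (set_type_infimum FB).
- move=> _ [b Bb <-].
  apply/(set_type_leP _ (set_type_of (cs_join_closed csBd (val a) (val b)))).
  by apply: xlb; exists b => //; exact: set_type_join.
Qed.
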